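(* Let $A=(A,\prec,\succ)$ be a noncommutative Novikov algebra and $(V,\ell_\prec,r_\prec,\ell_\succ,r_\succ)$ a representation of $A$. Let $\widehat A:=A\ltimes V^*$ be the semi-direct product noncommutative Novikov algebra on $A\oplus V^*$ associated to the representation $(V^*,-r_\bullet^*,\ell_\succ^*,r_\prec^*,-\ell_\bullet^* )$ of $A$. Let $T:V\to A$ be a linear map, identified with the tensor $r_T\in V^*\otimes A\subseteq\widehat A\otimes\widehat A$. Then $r:=r_T-\sigma(r_T)$ is an antisymmetric solution of the Novikov Yang-Baxter equation in $\widehat A$ if and only if $T$ is an $\mathcal O$-operator of $(A,\prec,\succ)$ associated to $(V,\ell_\prec,r_\prec,\ell_\succ,r_\succ)$.
   Context: $\mathbf k$ is a field of characteristic $0$; all vector spaces are finite-dimensional over $\mathbf k$, tensor products are over $\mathbf k$. A noncommutative Novikov algebra is a vector space $A$ with bilinear operations $\prec,\succ$ such that, with $\bullet:=\prec+\succ$, $(x\succ y)\prec z=x\succ(y\prec z)$ and $(x\prec y)\bullet z=x\bullet(y\succ z)$ for all $x,y,z\in A$. For $\rho:A\to\mathrm{End}(V)$ linear, $\rho^*:A\to\mathrm{End}(V^* )$ is defined by $\langle\rho^*(x)u^*,v\rangle=\langle u^*,\rho(x)v\rangle$. Let $\sigma(x\otimes y)=y\otimes x$; $r$ is antisymmetric if $\sigma(r)=-r$. A representation of $(A,\prec,\succ)$ is $(V,\ell_\prec,r_\prec,\ell_\succ,r_\succ)$ with $V$ a vector space and linear maps $\ell_\prec,r_\prec,\ell_\succ,r_\succ:A\to\mathrm{End}(V)$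 such that, with $\ell_\bullet=\ell_\prec+\ell_\succ$, $r_\bullet=r_\prec+r_\succ$, for all $x,y\in A$: $\ell_\prec(x\succ y)=\ell_\succ(x)\ell_\prec(y)$; $r_\prec(x)\ell_\succ(y)=\ell_\succ(y)r_\prec(x)$; $r_\prec(x)r_\succ(y)=r_\succ(y\prec x)$; $\ell_\bullet(x\prec y)=\ell_\bullet(x)\ell_\succ(y)$; $r_\bullet(x)\ell_\prec(y)=\ell_\bullet(y)r_\succ(x)$; $r_\bullet(x)r_\prec(y)=r_\bullet(y\succ x)$. If $(V,\ell_\prec,r_\prec,\ell_\succ,r_\succ)$ is a representation then so is $(V^*,-r_\bullet^*,\ell_\succ^*,r_\prec^*,-\ell_\bullet^* )$ (the four maps listed in the order left-$\prec$, right-$\prec$, left-$\succ$, right-$\succ$). The semi-direct product associated to a representation $(W,\ell_\prec,r_\prec,\ell_\succ,r_\succ)$ is the noncommutative Novikov algebra on $A\oplus W$ with $(x+u)\prec'(y+v)=x\prec y+\ell_\prec(x)v+r_\prec(y)u$ and $(x+u)\succ'(y+v)=x\succ y+\ell_\succ(x)v+r_\succ(y)u$. $T:V\to A$ is identified with $r_T=\sum_ie_i^*\otimes T(e_i)$, where $\{e_i\}$ is a basis of $V$ and $\{e_i^*\}$ its dual basis. For $r=\sum_iu_i\otimes v_i\in B\otimes B$, the Novikov Yang-Baxter equation in a noncommutative Novikov algebra $(B,\prec,\succ)$ is $$\sum_{i,j}\big(u_i\succ u_j\otimes v_i\otimes v_j+u_i\otimes u_j\otimes v_i\prec v_j+u_i\otimes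 u_j\bullet v_i\otimes v_j\big)=0 .$$ A linear map $T:V\to A$ is an $\mathcal O$-operator of $(A,\prec,\succ)$ associated to $(V,\ell_\prec,r_\prec,\ell_\succ,r_\succ)$ if $T(u)*T(v)=T\big(\ell_*(T(u))v+r_*(T(v))u\big)$ for all $u,v\in V$ and $*\in\{\prec,\succ\}$. *)

(* Defs.v *)
From HB Require Import structures.
From mathcomp Require Import all_boot all_order all_algebra.

Set Implicit Arguments.
Unset Strict Implicit.
Unset Printing Implicit Defensive.

Import GRing.Theory.
Local Open Scope ring_scope.

Section Bilinear.
Variable k : fieldType.
Implicit Types U V W : vectType k.

Definition bilinear_fun U V W (f : U -> V -> W) : Prop :=
  (forall u, linear (f u)) /\ (forall v, linear (f^~ v)).

(* [linfun g] is the linear map g only when g is linear; see [lin_homE] and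
   [bilin_homE]. *)
Definition bilin_hom U V W (f : U -> V -> W) : 'Hom(U, 'Hom(V, W)) :=
  linfun (fun u => linfun (f u)).

Lemma lin_homE V W (g : V -> W) : linear g -> linfun g =1 g.
Proof.
move=> gL; pose m := GRing.isLinear.Build _ _ _ _ g gL.
pose gl : {linear V -> W} := HB.pack g m.
exact: (lfunE gl).
Qed.

Lemma bilin_homE U V W (f : U -> V -> W) : bilinear_fun f ->
  forall u v, bilin_hom f u v = f u v.
Proof.
case=> fr fl u v; rewrite /bilin_hom lin_homE ?lin_homE //.
move=> a x y; apply/lfunP => w.
by rewrite add_lfunE scale_lfunE !lin_homE // fl.
Qed.

Lemma bilinear_hom U V W (f : 'Hom(U, 'Hom(V, W))) :
  bilinear_fun (fun u v => f u v).
Proof.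
split=> [u|v] a x y; first by rewrite linearP.
by rewrite linearP add_lfunE scale_lfunE.
Qed.

Lemma linear_sumZ V W (g : V -> W) (gL : linear g) (I : Type) (s : seq I)
    (a : I -> k) (x : I -> V) :
  g (\sum_(i <- s) a i *: x i) = \sum_(i <- s) a i *: g (x i).
Proof.
have gE := lin_homE gL; rewrite -gE linear_sum; apply: eq_bigr => i _.
by rewrite -!gE linearZ.
Qed.

Lemma linear_sumE V W (g : V -> W) (gL : linear g) (I : Type) (s : seq I)
    (x : I -> V) :
  g (\sum_(i <- s) x i) = \sum_(i <- s) g (x i).
Proof.
have gE := lin_homE gL; rewrite -gE linear_sum; apply: eq_bigr => i _.
by rewrite -gE.
Qed.

End Bilinear.

Section Tensor.
Variable k : fieldType.
Implicit Types U V W : vectType k.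

(* The tensor product of U and V: the coordinates of a tensor with respect to
   the basis of pure tensors of vectors of vbasis {:U} and vbasis {:V}.  Its
   universal property is [tlift_pure], [tlift_linear] and [tlift_unique]. *)
Definition tens U V : vectType k := 'M[k]_(\dim {:U}, \dim {:V}).

Definition tpure U V (u : U) (v : V) : tens U V :=
  \matrix_(i, j) (coord (vbasis {:U}) i u * coord (vbasis {:V}) j v).

(* The linear map on U ⊗ V induced by a bilinear map f. *)
Definition tlift U V W (f : U -> V -> W) (t : tens U V) : W :=
  \sum_i \sum_j (t : 'M_(_, _)) i j *: f (vbasis {:U})`_i (vbasis {:V})`_j.

End Tensor.

Notation "u ⊗ v" := (tpure u v) (at level 40, left associativity) : ring_scope.

Section TensorTheory.
Variable k : fieldType.
Implicit Types U V W : vectType k.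

Lemma tpure_bilinear U V : bilinear_fun (@tpure k U V).
Proof.
split=> [u|v] a x y; apply/matrixP => i j; rewrite !mxE linearP /=.
  by rewrite mulrDr mulrCA.
by rewrite mulrDl mulrA.
Qed.

Lemma tlift_linear U V W (f : U -> V -> W) : linear (tlift f).
Proof.
move=> a s t; rewrite /tlift scaler_sumr -big_split /=.
apply: eq_bigr => i _; rewrite scaler_sumr -big_split /=.
by apply: eq_bigr => j _; rewrite !mxE scalerDl scalerA.
Qed.

Lemma tlift_pure U V W (f : U -> V -> W) : bilinear_fun f ->
  forall u v, tlift f (u ⊗ v) = f u v.
Proof.
case=> fr fl u v; rewrite /tlift.
rewrite [in RHS](coord_vbasis (memvf u)) (linear_sumZ (fl v)).
apply: eq_bigr => i _.
rewrite [in RHS](coord_vbasis (memvf v)) (linear_sumZ (fr _)) scaler_sumr.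
by apply: eq_bigr => j _; rewrite mxE scalerA.
Qed.

Lemma tens_decomp U V (t : tens U V) :
  t = \sum_i \sum_j
        (t : 'M_(_, _)) i j *: ((vbasis {:U})`_i ⊗ (vbasis {:V})`_j).
Proof.
apply/matrixP => p q; rewrite summxE (bigD1 p) //= summxE (bigD1 q) //=.
have fU := basis_free (vbasisP {:U}); have fV := basis_free (vbasisP {:V}).
rewrite !mxE !coord_free // !eqxx !mulr1 big1 => [|j jq]; last first.
  by rewrite !mxE !coord_free // (negPf jq) !mulr0.
rewrite addr0 big1 ?addr0 // => i ip; rewrite summxE big1 // => j _.
by rewrite !mxE !coord_free // (negPf ip) mul0r mulr0.
Qed.

Lemma tlift_unique U V W (g h : tens U V -> W) :
  linear g -> linear h -> (forall u v, g (u ⊗ v) = h (u ⊗ v)) -> g =1 h.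
Proof.
move=> gL hL gh t; rewrite (tens_decomp t) (linear_sumE gL) (linear_sumE hL).
apply: eq_bigr => i _; rewrite (linear_sumZ gL) (linear_sumZ hL).
by apply: eq_bigr => j _; rewrite gh.
Qed.

Definition tswap U V (t : tens U V) : tens V U := tlift (fun u v => v ⊗ u) t.

Lemma tswap_pure U V (u : U) (v : V) : tswap (u ⊗ v) = v ⊗ u.
Proof.
rewrite /tswap tlift_pure //; have [pr pl] := tpure_bilinear V U.
by split=> [x|y]; [apply: pl | apply: pr].
Qed.

Definition antisymmetric_tensor V (r : tens V V) : Prop := tswap r = - r.

Lemma tens_families U V (t : tens U V) :
  exists (n : nat) (u : 'I_n -> U) (v : 'I_n -> V), t = \sum_i u i ⊗ v i.
Proof.
have [_ pl] := tpure_bilinear U V; have [pr _] := tpure_bilinear U V.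
exists (\dim {:U}), (fun i => (vbasis {:U})`_i),
  (fun i => \sum_j (t : 'M_(_, _)) i j *: (vbasis {:V})`_j).
rewrite {1}(tens_decomp t); apply: eq_bigr => i _.
by rewrite (linear_sumZ (pr _)).
Qed.

End TensorTheory.

Section NcNovikov.
Variable k : fieldType.

Record ncNovikov (A : vectType k) := NcNovikov {
  prec : 'Hom(A, 'End(A));
  succ : 'Hom(A, 'End(A));
  bul := prec + succ;
  ncN_succ_prec : forall x y z, prec (succ x y) z = succ x (prec y z);
  ncN_prec_bul : forall x y z, bul (prec x y) z = bul x (succ y z)
}.

Record representation (A : vectType k) (N : ncNovikov A) (V : vectType k) :=
  Representation {
  lprec : 'Hom(A, 'End(V));
  rprec : 'Hom(A, 'End(V));
  lsucc : 'Hom(A, 'End(V));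
  rsucc : 'Hom(A, 'End(V));
  lbul := lprec + lsucc;
  rbul := rprec + rsucc;
  rep_lprec_succ : forall x y, lprec (succ N x y) = (lsucc x \o lprec y)%VF;
  rep_rprec_lsucc : forall x y,
    (rprec x \o lsucc y)%VF = (lsucc y \o rprec x)%VF;
  rep_rprec_rsucc : forall x y, (rprec x \o rsucc y)%VF = rsucc (prec N y x);
  rep_lbul_prec : forall x y, lbul (prec N x y) = (lbul x \o lsucc y)%VF;
  rep_rbul_lprec : forall x y, (rbul x \o lprec y)%VF = (lbul y \o rsucc x)%VF;
  rep_rbul_rprec : forall x y, (rbul x \o rprec y)%VF = rbul (succ N y x)
}.

Definition dual (V : vectType k) : vectType k := 'Hom(V, k^o).

Definition dual_map (A V : vectType k) (rho : 'Hom(A, 'End(V))) :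
    'Hom(A, 'End(dual V)) :=
  bilin_hom (fun x (u : dual V) => (u \o rho x)%VF : dual V).

Lemma dual_mapE (A V : vectType k) (rho : 'Hom(A, 'End(V))) x (u : dual V) :
  dual_map rho x u = (u \o rho x)%VF.
Proof.
rewrite /dual_map bilin_homE //; split=> [y|w] a p q; apply/lfunP => v.
  by rewrite !(comp_lfunE, add_lfunE, scale_lfunE).
by rewrite linearP !(comp_lfunE, add_lfunE, scale_lfunE) linearP.
Qed.

Lemma dual_mapD (A V : vectType k) (f g : 'Hom(A, 'End(V))) :
  dual_map (f + g) = dual_map f + dual_map g.
Proof.
apply/lfunP => x; apply/lfunP => u; rewrite !add_lfunE !dual_mapE.
by apply/lfunP => v; rewrite !(comp_lfunE, add_lfunE) linearD.
Qed.

Section DualRep.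
Variables (A V : vectType k) (N : ncNovikov A) (R : representation N V).

Let dlp := - dual_map (rbul R).
Let drp := dual_map (lsucc R).
Let dls := dual_map (rprec R).
Let drs := - dual_map (lbul R).

Let dlbE : dlp + dls = - dual_map (rsucc R).
Proof. by rewrite /dlp /dls /rbul dual_mapD opprD addrAC addNr add0r. Qed.

Let drbE : drp + drs = - dual_map (lprec R).
Proof. by rewrite /drp /drs /lbul dual_mapD opprD addrCA subrr addr0. Qed.

Let dualE := (opp_lfunE, comp_lfunE, dual_mapE).

Lemma dual_rep1 x y : dlp (succ N x y) = (dls x \o dlp y)%VF.
Proof.
apply/lfunP => u; rewrite !dualE -rep_rbul_rprec.
by apply/lfunP => v; rewrite !dualE.
Qed.

Lemma dual_rep2 x y : (drp x \o dls y)%VF = (dls y \o drp x)%VF.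
Proof.
apply/lfunP => u; rewrite !dualE; apply/lfunP => v; rewrite !dualE.
by have /lfunP/(_ v) := rep_rprec_lsucc R y x; rewrite !comp_lfunE => ->.
Qed.

Lemma dual_rep3 x y : (drp x \o drs y)%VF = drs (prec N y x).
Proof.
apply/lfunP => u; rewrite !dualE rep_lbul_prec.
by apply/lfunP => v; rewrite !dualE.
Qed.

Lemma dual_rep4 x y : (dlp + dls) (prec N x y) = ((dlp + dls) x \o dls y)%VF.
Proof.
rewrite dlbE; apply/lfunP => u; rewrite !dualE -rep_rprec_rsucc.
by apply/lfunP => v; rewrite !dualE.
Qed.

Lemma dual_rep5 x y : ((drp + drs) x \o dlp y)%VF = ((dlp + dls) y \o drs x)%VF.
Proof.
rewrite dlbE drbE; apply/lfunP => u; rewrite !dualE.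
apply/lfunP => v; rewrite !dualE.
by have /lfunP/(_ v) := rep_rbul_lprec R y x; rewrite !comp_lfunE => ->.
Qed.

Lemma dual_rep6 x y : ((drp + drs) x \o drp y)%VF = (drp + drs) (succ N y x).
Proof.
rewrite drbE; apply/lfunP => u; rewrite !dualE rep_lprec_succ.
by apply/lfunP => v; rewrite !dualE.
Qed.

Definition dual_rep : representation N (dual V) :=
  @Representation A N (dual V)
    (- dual_map (rbul R)) (dual_map (lsucc R))
    (dual_map (rprec R)) (- dual_map (lbul R))
    dual_rep1 dual_rep2 dual_rep3 dual_rep4 dual_rep5 dual_rep6.

End DualRep.

Section SemiDirect.
Variables (A W : vectType k) (N : ncNovikov A) (R : representation N W).

Definition dsum : vectType k := (A * W)%type.

Definition sd_op (op : 'Hom(A, 'End(A))) (l r : 'Hom(A, 'End(W))) :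
    'Hom(dsum, 'End(dsum)) :=
  bilin_hom (fun p q : dsum => (op p.1 q.1, l p.1 q.2 + r q.1 p.2) : dsum).

Lemma sd_opE op l r (p q : dsum) :
  sd_op op l r p q = (op p.1 q.1, l p.1 q.2 + r q.1 p.2).
Proof.
rewrite /sd_op bilin_homE //; split=> [x|y] a u v; congr (_, _) => /=.
- by rewrite linearP.
- rewrite !linearP !(add_lfunE, scale_lfunE) scalerDr.
  by rewrite addrACA.
- by rewrite linearP !(add_lfunE, scale_lfunE).
rewrite !linearP !(add_lfunE, scale_lfunE) scalerDr.
by rewrite addrACA.
Qed.

Let P := sd_op (prec N) (lprec R) (rprec R).
Let S := sd_op (succ N) (lsucc R) (rsucc R).

Let PSE : P + S = sd_op (bul N) (lbul R) (rbul R).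
Proof.
apply/lfunP => p; apply/lfunP => q; rewrite !add_lfunE !sd_opE /bul /lbul /rbul.
rewrite !add_lfunE; congr (_, _) => /=; exact: addrACA.
Qed.

Lemma sd_succ_prec (x y z : dsum) : P (S x y) z = S x (P y z).
Proof.
rewrite !sd_opE /= ncN_succ_prec; congr (_, _).
rewrite !linearD /= rep_lprec_succ -rep_rprec_rsucc !comp_lfunE -!addrA.
have /lfunP/(_ y.2) := rep_rprec_lsucc R z.1 x.1.
by rewrite !comp_lfunE => ->.
Qed.

Lemma sd_prec_bul (x y z : dsum) : (P + S) (P x y) z = (P + S) x (S y z).
Proof.
rewrite PSE !sd_opE /= ncN_prec_bul; congr (_, _).
rewrite !linearD /= rep_lbul_prec -rep_rbul_rprec !comp_lfunE -!addrA.
have /lfunP/(_ y.2) := rep_rbul_lprec R z.1 x.1.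
by rewrite !comp_lfunE => ->.
Qed.

Definition semidirect : ncNovikov dsum :=
  @NcNovikov dsum (sd_op (prec N) (lprec R) (rprec R))
    (sd_op (succ N) (lsucc R) (rsucc R)) sd_succ_prec sd_prec_bul.

End SemiDirect.

Section NYBE.
Variables (B : vectType k) (N : ncNovikov B).

Definition nybe_lhs n (u v : 'I_n -> B) : tens (tens B B) B :=
  \sum_i \sum_j (succ N (u i) (u j) ⊗ v i ⊗ v j
                 + u i ⊗ u j ⊗ prec N (v i) (v j)
                 + u i ⊗ bul N (u j) (v i) ⊗ v j).

(* Decompositions always exist [tens_families], and the left-hand side does
   not depend on the one chosen [nybe_lhs_wd]. *)
Definition is_NYBE_solution (r : tens B B) : Prop :=
  forall n (u v : 'I_n -> B), r = \sum_i u i ⊗ v i -> nybe_lhs u v = 0.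

Let G (u v u' v' : B) : tens (tens B B) B :=
  succ N u u' ⊗ v ⊗ v' + u ⊗ u' ⊗ prec N v v' + u ⊗ bul N u' v ⊗ v'.

Let tpDl (U V : vectType k) (x y : U) (z : V) a :
  (a *: x + y) ⊗ z = a *: (x ⊗ z) + y ⊗ z.
Proof. by have [_ ->] := tpure_bilinear U V. Qed.

Let tpDr (U V : vectType k) (x y : V) (z : U) a :
  z ⊗ (a *: x + y) = a *: (z ⊗ x) + z ⊗ y.
Proof. by have [-> _] := tpure_bilinear U V. Qed.

Let lin2 := (linearP, add_lfunE, scale_lfunE, tpDl, tpDr, scalerDr).

Let addr6 (M : zmodType) (a b c d e f : M) :
  (a + d) + (b + e) + (c + f) = (a + b + c) + (d + e + f).
Proof. by rewrite [a + d + (b + e)]addrACA [LHS]addrACA. Qed.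

Let G_bil2 u v : bilinear_fun (G u v).
Proof.
by split=> [x|y] a p q; rewrite /G; move: (bul N) => b; rewrite !lin2 /= addr6.
Qed.

Let tlift_fun (W : vectType k) a (f g h : B -> B -> W) t :
  (forall x y, f x y = a *: g x y + h x y) ->
  tlift f t = a *: tlift g t + tlift h t.
Proof.
move=> E; rewrite /tlift scaler_sumr -big_split /=; apply: eq_bigr => i _.
rewrite scaler_sumr -big_split /=; apply: eq_bigr => j _.
by rewrite E scalerDr !scalerA mulrC.
Qed.

Let G_bil1 r : bilinear_fun (fun u v => tlift (G u v) r).
Proof.
split=> [u|v] a p q; apply: tlift_fun => x y; rewrite /G;
by move: (bul N) => b; rewrite !lin2 /= addr6.
Qed.

Lemma nybe_lhs_wd n m (u v : 'I_n -> B) (u' v' : 'I_m -> B) :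
  \sum_i u i ⊗ v i = \sum_i u' i ⊗ v' i -> nybe_lhs u v = nybe_lhs u' v'.
Proof.
suff H l (x y : 'I_l -> B) t : t = \sum_i x i ⊗ y i ->
    nybe_lhs x y = tlift (fun p q => tlift (G p q) t) t.
  by move=> E; rewrite (H _ _ _ _ (erefl _)) E -(H _ _ _ _ (erefl _)).
move=> tE; rewrite [X in tlift _ X]tE (linear_sumE (tlift_linear _)).
apply: eq_bigr => i _; rewrite (tlift_pure (G_bil1 t)).
rewrite [X in tlift _ X]tE (linear_sumE (tlift_linear _)).
by apply: eq_bigr => j _; rewrite tlift_pure.
Qed.

End NYBE.

Section OOperator.
Variables (A V : vectType k).

Definition O_operator (N : ncNovikov A) (R : representation N V)
    (T : 'Hom(V, A)) : Prop :=
  (forall u v, prec N (T u) (T v) = T (lprec R (T u) v + rprec R (T v) u)) /\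
  (forall u v, succ N (T u) (T v) = T (lsucc R (T u) v + rsucc R (T v) u)).

(* The tensor of T computed in a basis e; e_i^* is the i-th coordinate form. *)
Definition tensor_of (e : (\dim {:V}).-tuple V) (T : 'Hom(V, A)) :
    tens (dual V) A :=
  \sum_i (linfun (coord e i : V -> k^o) : dual V) ⊗ T e`_i.

Definition embed (t : tens (dual V) A) :
    tens (dsum A (dual V)) (dsum A (dual V)) :=
  tlift (fun (f : dual V) (a : A) =>
           ((0, f) : dsum A (dual V)) ⊗ ((a, 0) : dsum A (dual V))) t.

Lemma embed_pure (f : dual V) (a : A) :
  embed (f ⊗ a) = ((0, f) : dsum A (dual V)) ⊗ ((a, 0) : dsum A (dual V)).
Proof.
have [pr pl] := tpure_bilinear (dsum A (dual V)) (dsum A (dual V)).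
rewrite /embed tlift_pure //; split=> [g|b] c x y.
  have -> : ((c *: x + y, 0) : dsum A (dual V)) = c *: (x, 0) + (y, 0).
    by congr (_, _); rewrite /= scaler0 addr0.
  exact: pr.
have -> : ((0, c *: x + y) : dsum A (dual V)) = c *: (0, x) + (0, y).
  by congr (_, _); rewrite /= scaler0 addr0.
exact: pl.
Qed.

End OOperator.

End NcNovikov.

(* Main.v *)
Require Import Defs.
From mathcomp Require Import all_boot all_order all_algebra.

Import GRing.Theory.
Local Open Scope ring_scope.

(** Write f_i for the basis of [dual V] dual to e_i, t_i for T e_i, and regard
    A and V* as subspaces of [semidirect (dual_rep R)].  Then r is the sum of
    the f_i ⊗ t_i - t_i ⊗ f_i, and it is antisymmetric because the swap is an
    involution.

    In the Yang-Baxter expression of r every product of two elements of V*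
    vanishes, so each surviving term has one factor in A and two in V*.  Up
    to sign, a product of t_i and f_j is f_j precomposed with an endomorphism
    of V given by the representation.  Since the sum of the (f_i \o S) ⊗ e_i equals the
    sum of the f_i ⊗ S e_i ([transpose_dual_basis]), such an endomorphism can
    be moved to the other leg, under T ([sum_O_defect]).  After this step the
    expression is the sum over i and j of
      f_i ⊗ f_j ⊗ P(e_i, e_j) + S(e_i, e_j) ⊗ f_i ⊗ f_j
        - f_j ⊗ (P + S)(e_i, e_j) ⊗ f_i
    ([nybe_skew]), where P and S measure how far T is from satisfying the two
    equations of an O-operator ([O_defect]).  With the
    adjoint maps of [dual_rep], the terms with the A-component in the third,
    first and second leg involve only the representation maps of prec, of
    succ and of their sum respectively, which is why they assemble into the
    defects of these three operations.

    If T is an O-operator then P = S = 0 and the expression vanishes.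
    Conversely the three sums lie in different summands of the triple tensor
    power of A ⊕ V*, and evaluating the two V*-legs at u and v turns the first
    one into P(u, v) and the second one into S(u, v) ([nybe_skew_eq0]). *)

(** * Linear and trilinear maps *)

Section Multilinear.
Set Implicit Arguments.
Unset Strict Implicit.
Variable k : fieldType.
Implicit Types U V W : vectType k.

Lemma linear_fun0 V W (g : V -> W) : linear g -> g 0 = 0.
Proof. by move=> gL; rewrite -(lin_homE gL) linear0. Qed.

Lemma linear_funN V W (g : V -> W) : linear g -> {morph g : x / - x}.
Proof. by move=> gL x; rewrite -!(lin_homE gL) linearN. Qed.

Lemma linear_funD V W (g : V -> W) : linear g -> {morph g : x y / x + y}.
Proof. by move=> gL x y; rewrite -!(lin_homE gL) linearD. Qed.

Lemma linear_funB V W (g : V -> W) : linear g -> {morph g : x y / x - y}.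
Proof. by move=> gL x y; rewrite -!(lin_homE gL) linearB. Qed.

Definition trilinear_fun U V U' W (F : U -> V -> U' -> W) : Prop :=
  [/\ forall y z, linear (fun x => F x y z),
      forall x z, linear (fun y => F x y z)
    & forall x y, linear (F x y)].

Lemma tpure3_trilinear U V W :
  trilinear_fun (fun (x : U) (y : V) (z : W) => x ⊗ y ⊗ z).
Proof.
have [r1 l1] := tpure_bilinear U V; have [r2 l2] := tpure_bilinear (tens U V) W.
split=> [y z|x z|x y] a p q /=; last exact: r2.
  by rewrite l1 l2.
by rewrite r1 l2.
Qed.

(** The tensors here are nested pairs, so a trilinear map is lifted by lifting
    twice, the inner lift being taken with the third variable fixed. *)
Definition tlift3 U V U' W (F : U -> V -> U' -> W) :
    tens (tens U V) U' -> W :=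
  tlift (fun t z => tlift (fun x y => F x y z) t).

Lemma tlift3_pure U V U' W (F : U -> V -> U' -> W) : trilinear_fun F ->
  forall x y z, tlift3 F (x ⊗ y ⊗ z) = F x y z.
Proof.
case=> F1 F2 F3 x y z.
have F12 c : bilinear_fun (fun x y => F x y c).
  by split=> ?; [exact: F2 | exact: F1].
rewrite /tlift3 tlift_pure ?tlift_pure //.
split=> [t|c]; last exact: tlift_linear.
move=> a p q; rewrite /tlift scaler_sumr -big_split /=; apply: eq_bigr => i _.
rewrite scaler_sumr -big_split /=; apply: eq_bigr => j _.
by rewrite F3 scalerDr !scalerA mulrC.
Qed.

Lemma tswapK U V : cancel (@tswap k U V) (@tswap k V U).
Proof.
apply: tlift_unique => [a s t|a s t|u v]; rewrite ?tswap_pure //.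
by rewrite /tswap !(tlift_linear _ _ _ _).
Qed.

Lemma antisymmetrize V (t : tens V V) : antisymmetric_tensor (t - tswap t).
Proof.
have swapL : linear (@tswap k V V) := tlift_linear _.
by rewrite /antisymmetric_tensor (linear_funB swapL) tswapK opprB.
Qed.

End Multilinear.

(** * Dual bases *)

Section DualBasis.
Set Implicit Arguments.
Unset Strict Implicit.
Variables (k : fieldType) (V : vectType k) (e : (\dim {:V}).-tuple V).
Hypothesis e_basis : basis_of {:V} e.

Definition dual_basis (i : 'I_(\dim {:V})) : dual V :=
  linfun (coord e i : V -> k^o).
Local Notation f := dual_basis.

Lemma dual_basisE i v : f i v = coord e i v.
Proof. by rewrite lin_homE // => a x y; rewrite linearP. Qed.

Lemma dual_basis_expand v : v = \sum_i (f i v : k) *: e`_i.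
Proof.
rewrite {1}(coord_basis e_basis (memvf v)).
by apply: eq_bigr => i _; rewrite dual_basisE.
Qed.

Lemma dual_expand (g : dual V) : g = \sum_(i < \dim {:V}) (g e`_i : k) *: f i.
Proof.
apply/lfunP => v; rewrite {1}(dual_basis_expand v) linear_sum sum_lfunE.
by apply: eq_bigr => i _; rewrite linearZ scale_lfunE /= [LHS]mulrC.
Qed.

Lemma bilinear_expand (W : vectType k) (F : V -> V -> W) : bilinear_fun F ->
  forall u v, F u v = \sum_i \sum_j ((f i u : k) * (f j v : k)) *: F e`_i e`_j.
Proof.
case=> Fr Fl u v.
rewrite {1}(dual_basis_expand u) (linear_sumZ (Fl v)); apply: eq_bigr => i _.
rewrite {1}(dual_basis_expand v) (linear_sumZ (Fr _)) scaler_sumr.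
by apply: eq_bigr => j _; rewrite scalerA.
Qed.

(** Both sides are the image under F of the same element of V* ⊗ V, namely the
    tensor that represents the endomorphism S. *)
Lemma transpose_dual_basis (W : vectType k) (F : dual V -> V -> W)
    (S : 'End(V)) : bilinear_fun F ->
  \sum_(i < \dim {:V}) F (f i \o S)%VF e`_i = \sum_i F (f i) (S e`_i).
Proof.
case=> Fr Fl.
under eq_bigr => i _ do
  rewrite (dual_expand (f i \o S)%VF) (linear_sumZ (Fl _)).
rewrite exchange_big; apply: eq_bigr => j _ /=.
rewrite [in RHS](dual_basis_expand (S e`_j)) (linear_sumZ (Fr _)).
by apply: eq_bigr => i _; rewrite comp_lfunE.
Qed.

End DualBasis.

(** * The defect of an O-operator *)

Section Defect.
Set Implicit Arguments.
Unset Strict Implicit.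
Variables (k : fieldType) (A V : vectType k) (T : 'Hom(V, A)).
Implicit Types (op : 'Hom(A, 'End(A))) (l r : 'Hom(A, 'End(V))).

Definition O_defect op l r (u v : V) : A :=
  op (T u) (T v) - T (l (T u) v + r (T v) u).

Lemma O_defect_bilinear op l r : bilinear_fun (O_defect op l r).
Proof.
split=> [u|v] a x y; rewrite /O_defect;
  rewrite !(linearP, add_lfunE, scale_lfunE) /= [X in _ - T X]addrACA -scalerDr;
  by rewrite linearP opprD addrACA scalerBr.
Qed.

(** The defect is additive in the operation together with its two actions,
    so the defect of the operation [bul] is the sum of the other two. *)
Lemma O_defectD op1 l1 r1 op2 l2 r2 u v :
  O_defect (op1 + op2) (l1 + l2) (r1 + r2) u v =
  O_defect op1 l1 r1 u v + O_defect op2 l2 r2 u v.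
Proof.
by rewrite /O_defect !add_lfunE [X in _ - T X]addrACA linearD opprD addrACA.
Qed.

Lemma O_operator_defect (N : ncNovikov A) (R : representation N V) :
  O_operator R T <->
  forall u v, O_defect (prec N) (lprec R) (rprec R) u v = 0 /\
              O_defect (succ N) (lsucc R) (rsucc R) u v = 0.
Proof.
split=> [[hP hS] u v|h]; first by rewrite /O_defect hP hS !subrr.
by split=> u v; have [/subr0_eq hP /subr0_eq hS] := h u v.
Qed.

End Defect.

(** * The Yang-Baxter expression of a skew-symmetrized operator *)

Section YangBaxter.
Set Implicit Arguments.
Unset Strict Implicit.
Variables (k : fieldType) (A V : vectType k) (T : 'Hom(V, A)).
Variables (e : (\dim {:V}).-tuple V).
Hypothesis e_basis : basis_of {:V} e.

Local Notation f := (dual_basis e).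
Local Notation n := (\dim {:V}).

(** The terms of the Yang-Baxter equation that involve one given operation
    have this shape, with F placing its arguments in the three legs.
    Transposing l and r from the functionals to the basis vectors turns the
    last two sums into the two correction terms of the defect. *)
Lemma sum_O_defect (W : vectType k) (F : dual V -> dual V -> A -> W)
    (op : 'Hom(A, 'End(A))) (l r : 'Hom(A, 'End(V))) : trilinear_fun F ->
  \sum_(i < n) \sum_(j < n) F (f i) (f j) (op (T e`_i) (T e`_j))
  - \sum_(i < n) \sum_(j < n) F (f i) (f j \o l (T e`_i))%VF (T e`_j)
  - \sum_(i < n) \sum_(j < n) F (f i \o r (T e`_j))%VF (f j) (T e`_i)
  = \sum_(i < n) \sum_(j < n) F (f i) (f j) (O_defect T op l r e`_i e`_j).
Proof.
case=> F1 F2 F3.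
have -> : \sum_(i < n) \sum_(j < n) F (f i) (f j \o l (T e`_i))%VF (T e`_j)
        = \sum_(i < n) \sum_(j < n) F (f i) (f j) (T (l (T e`_i) e`_j)).
  apply: eq_bigr => i _.
  apply: (transpose_dual_basis e_basis (F := fun g v => F (f i) g (T v))).
  by split=> [g|v] a x y; rewrite ?linearP ?F3 ?F2.
have -> : \sum_(i < n) \sum_(j < n) F (f i \o r (T e`_j))%VF (f j) (T e`_i)
        = \sum_(i < n) \sum_(j < n) F (f i) (f j) (T (r (T e`_j) e`_i)).
  rewrite exchange_big [RHS]exchange_big; apply: eq_bigr => j _ /=.
  apply: (transpose_dual_basis e_basis (F := fun g v => F g (f j) (T v))).
  by split=> [g|v] a x y; rewrite ?linearP ?F3 ?F1.
rewrite -!sumrB; apply: eq_bigr => i _; rewrite -!sumrB; apply: eq_bigr => j _.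
by rewrite -!(linear_funB (F3 _ _)) /O_defect linearD opprD addrA.
Qed.

Local Notation B := (dsum A (dual V)).

Definition in_alg (a : A) : B := (a, 0).
Definition in_dual (g : dual V) : B := (0, g).

Lemma in_alg_linear : linear in_alg.
Proof. by move=> a x y; congr (_, _); rewrite /= scaler0 addr0. Qed.

Lemma in_dual_linear : linear in_dual.
Proof. by move=> a x y; congr (_, _); rewrite /= scaler0 addr0. Qed.

(** [skew_fst] and [skew_snd] list the legs of r: the first half of the index
    set carries the terms f_i ⊗ t_i, the second half the terms - t_i ⊗ f_i, with
    the sign put on the first leg. *)
Definition skew_fst (i : 'I_(n + n)) : B :=
  match split i with inl i => in_dual (f i) | inr i => - in_alg (T e`_i) end.

Definition skew_snd (i : 'I_(n + n)) : B :=
  match split i with inl i => in_alg (T e`_i) | inr i => in_dual (f i) end.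

Lemma skew_l (i : 'I_n) :
  (skew_fst (lshift n i) = in_dual (f i)) *
  (skew_snd (lshift n i) = in_alg (T e`_i)).
Proof. by rewrite /skew_fst /skew_snd (unsplitK (inl i)). Qed.

Lemma skew_r (i : 'I_n) :
  (skew_fst (rshift n i) = - in_alg (T e`_i)) *
  (skew_snd (rshift n i) = in_dual (f i)).
Proof. by rewrite /skew_fst /skew_snd (unsplitK (inr i)). Qed.

Lemma skew_tensorE (rT := embed (tensor_of e T)) :
  rT - tswap rT = \sum_i skew_fst i ⊗ skew_snd i.
Proof.
have swapL : linear (@tswap k B B) := tlift_linear _.
have embedL : linear (@embed k A V) := tlift_linear _.
have -> : rT = \sum_(i < n) in_dual (f i) ⊗ in_alg (T e`_i).
  rewrite /rT /tensor_of (linear_sumE embedL).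
  by apply: eq_bigr => i _; exact: embed_pure.
rewrite big_split_ord /= (linear_sumE swapL) -sumrN; congr (_ + _).
  by apply: eq_bigr => i _; rewrite !skew_l.
apply: eq_bigr => i _; rewrite !skew_r tswap_pure.
by have [_ pl] := tpure_bilinear B B; rewrite (linear_funN (pl _)).
Qed.

Variables (N : ncNovikov A) (R : representation N V).
Local Notation Ahat := (semidirect (dual_rep R)).

Let sdE := (add_lfunE, opp_lfunE, sd_opE, dual_mapE).
Let zeroE :=
  (linear0, zero_lfunE, comp_lfun0l, comp_lfun0r, oppr0, add0r, addr0).

Lemma precAA a b : prec Ahat (in_alg a) (in_alg b) = in_alg (prec N a b).
Proof. by rewrite /= !sdE /= !zeroE. Qed.

Lemma precAV a g : prec Ahat (in_alg a) (in_dual g) =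
  - in_dual (g \o rbul R a)%VF.
Proof. by rewrite -(linear_funN in_dual_linear) /= !sdE /= !zeroE. Qed.

Lemma precVA g b : prec Ahat (in_dual g) (in_alg b) =
  in_dual (g \o lsucc R b)%VF.
Proof. by rewrite /= !sdE /= !zeroE. Qed.

Lemma precVV g h : prec Ahat (in_dual g) (in_dual h) = 0.
Proof. by rewrite /= !sdE /= !zeroE. Qed.

Lemma succAA a b : succ Ahat (in_alg a) (in_alg b) = in_alg (succ N a b).
Proof. by rewrite /= !sdE /= !zeroE. Qed.

Lemma succAV a g : succ Ahat (in_alg a) (in_dual g) =
  in_dual (g \o rprec R a)%VF.
Proof. by rewrite /= !sdE /= !zeroE. Qed.

Lemma succVA g b : succ Ahat (in_dual g) (in_alg b) =
  - in_dual (g \o lbul R b)%VF.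
Proof. by rewrite -(linear_funN in_dual_linear) /= !sdE /= !zeroE. Qed.

Lemma succVV g h : succ Ahat (in_dual g) (in_dual h) = 0.
Proof. by rewrite /= !sdE /= !zeroE. Qed.

Lemma bulE (C : vectType k) (M : ncNovikov C) x y :
  bul M x y = prec M x y + succ M x y.
Proof. by rewrite /bul !add_lfunE. Qed.

Lemma bulAA a b : bul Ahat (in_alg a) (in_alg b) = in_alg (bul N a b).
Proof. by rewrite !bulE precAA succAA (linear_funD in_alg_linear). Qed.

(** In the sum of the two operations the adjoints of [rprec] (and, in
    [bulVA], of [lsucc]) cancel, leaving a single action. *)
Lemma bulAV a g : bul Ahat (in_alg a) (in_dual g) =
  - in_dual (g \o rsucc R a)%VF.
Proof.
rewrite bulE precAV succAV /rbul add_lfunE comp_lfunDr.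
by rewrite (linear_funD in_dual_linear) opprD addrAC addNr add0r.
Qed.

Lemma bulVA g b : bul Ahat (in_dual g) (in_alg b) =
  - in_dual (g \o lprec R b)%VF.
Proof.
rewrite bulE precVA succVA /lbul add_lfunE comp_lfunDr.
by rewrite (linear_funD in_dual_linear) opprD addrCA subrr addr0.
Qed.

Lemma bulVV g h : bul Ahat (in_dual g) (in_dual h) = 0.
Proof. by rewrite bulE precVV succVV addr0. Qed.

Let tensN (U W : vectType k) (x : U) (y : W) :
  ((- x) ⊗ y = - (x ⊗ y)) * (x ⊗ (- y) = - (x ⊗ y)).
Proof.
have [tr tl] := tpure_bilinear U W.
by rewrite (linear_funN (tl _)) (linear_funN (tr _)).
Qed.

Let tens0l (U W : vectType k) (y : W) : (0 : U) ⊗ y = 0.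
Proof. by have [_ tl] := tpure_bilinear U W; rewrite (linear_fun0 (tl _)). Qed.

Let tens0r (U W : vectType k) (x : U) : x ⊗ (0 : W) = 0.
Proof. by have [tr _] := tpure_bilinear U W; rewrite (linear_fun0 (tr _)). Qed.

Let opE := (precAA, precAV, precVA, precVV, succAA, succAV, succVA, succVV,
            bulAA, bulAV, bulVA, bulVV).

Local Notation P := (O_defect T (prec N) (lprec R) (rprec R)).
Local Notation S := (O_defect T (succ N) (lsucc R) (rsucc R)).
Local Notation D := (O_defect T (bul N) (lbul R) (rbul R)).

(** The three ways of placing the A-component that occur in the equation; each
    one collects the terms of one operation: prec, succ and bul. *)
Lemma placed_trilinear :
  [/\ trilinear_fun (fun g h a => in_dual g ⊗ in_dual h ⊗ in_alg a),
      trilinear_fun (fun g h a => in_alg a ⊗ in_dual g ⊗ in_dual h)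
    & trilinear_fun (fun g h a => in_dual h ⊗ in_alg a ⊗ in_dual g)].
Proof.
have [t1 t2 t3] := tpure3_trilinear B B B.
have iA := in_alg_linear; have iV := in_dual_linear.
by split; split=> x y a u v; rewrite ?iA ?iV ?t1 ?t2 ?t3.
Qed.

Let nybe_term (x y x' y' : B) : tens (tens B B) B :=
  succ Ahat x x' ⊗ y ⊗ y' + x ⊗ x' ⊗ prec Ahat y y' + x ⊗ bul Ahat x' y ⊗ y'.

Let homN (op : 'Hom(B, 'End(B))) x y :
  (op (- x) y = - op x y) * (op x (- y) = - op x y).
Proof. by rewrite !linearN opp_lfunE. Qed.

Let nybe_term_ll g a h b :
  nybe_term (in_dual g) (in_alg a) (in_dual h) (in_alg b) =
    in_dual g ⊗ in_dual h ⊗ in_alg (prec N a b)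
  - in_dual g ⊗ in_dual (h \o lprec R a)%VF ⊗ in_alg b.
Proof. by rewrite /nybe_term !opE !(tens0l, tens0r, oppr0, tensN) add0r. Qed.

Let nybe_term_lr g a b h :
  nybe_term (in_dual g) (in_alg a) (- in_alg b) (in_dual h) =
    in_dual (g \o lbul R b)%VF ⊗ in_alg a ⊗ in_dual h
  + in_dual g ⊗ in_alg b ⊗ in_dual (h \o rbul R a)%VF
  - in_dual g ⊗ in_alg (bul N b a) ⊗ in_dual h.
Proof.
by rewrite /nybe_term !homN !opE !(tens0l, tens0r, oppr0, tensN, opprK).
Qed.

Let nybe_term_rl a g h b :
  nybe_term (- in_alg a) (in_dual g) (in_dual h) (in_alg b) =
  - (in_dual (h \o rprec R a)%VF ⊗ in_dual g ⊗ in_alg b)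
  - in_alg a ⊗ in_dual h ⊗ in_dual (g \o lsucc R b)%VF.
Proof.
by rewrite /nybe_term !homN !opE !(tens0l, tens0r, oppr0, tensN) addr0.
Qed.

Let nybe_term_rr a g b h :
  nybe_term (- in_alg a) (in_dual g) (- in_alg b) (in_dual h) =
    in_alg (succ N a b) ⊗ in_dual g ⊗ in_dual h
  - in_alg a ⊗ in_dual (g \o rsucc R b)%VF ⊗ in_dual h.
Proof.
rewrite /nybe_term !homN !opE !(tens0l, tens0r, oppr0, tensN, opprK).
by rewrite addr0.
Qed.

Lemma nybe_skew :
  nybe_lhs Ahat skew_fst skew_snd =
    \sum_(i < n) \sum_(j < n)
      in_dual (f i) ⊗ in_dual (f j) ⊗ in_alg (P e`_i e`_j)
  + \sum_(i < n) \sum_(j < n)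
      in_alg (S e`_i e`_j) ⊗ in_dual (f i) ⊗ in_dual (f j)
  - \sum_(i < n) \sum_(j < n)
      in_dual (f j) ⊗ in_alg (D e`_i e`_j) ⊗ in_dual (f i).
Proof.
have [tP tS tD] := placed_trilinear.
rewrite -(sum_O_defect _ _ _ tP) -(sum_O_defect _ _ _ tS).
rewrite -(sum_O_defect _ _ _ tD).
(* These five sums have i and j interchanged with respect to the terms of the
   Yang-Baxter expression. *)
rewrite [X in _ - _ - X + _]exchange_big [X in _ + (_ - X - _)]exchange_big.
rewrite [X in _ - (X - _ - _)]exchange_big [X in _ - (_ - X - _)]exchange_big.
rewrite [X in _ - (_ - _ - X)]exchange_big -!sumrB -big_split -sumrB /=.
transitivity (\sum_(i < n + n) \sum_(j < n + n)
    nybe_term (skew_fst i) (skew_snd i) (skew_fst j) (skew_snd j)); first by [].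
rewrite big_split_ord /= -big_split; apply: eq_bigr => i _ /=.
rewrite !big_split_ord /= -!sumrB -!big_split -sumrB /=; apply: eq_bigr => j _.
rewrite !(skew_l, skew_r) nybe_term_ll nybe_term_lr nybe_term_rl nybe_term_rr.
rewrite !opprB.
(* Nine terms on each side; only their order differs. *)
by rewrite [LHS](AC ((2 * (2 * 1)) * (2 * 2))
                    ((1 * 2 * 6) * (8 * 7 * 9) * (4 * (3 * 5)))).
Qed.

(** This is [nybe_skew] under the linear map that F induces on triple
    tensors. *)
Lemma contraction (C : vectType k) (F : B -> B -> B -> C) : trilinear_fun F ->
  nybe_lhs Ahat skew_fst skew_snd = 0 ->
  \sum_(i < n) \sum_(j < n)
    F (in_dual (f i)) (in_dual (f j)) (in_alg (P e`_i e`_j))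
  + \sum_(i < n) \sum_(j < n)
    F (in_alg (S e`_i e`_j)) (in_dual (f i)) (in_dual (f j))
  = \sum_(i < n) \sum_(j < n)
    F (in_dual (f j)) (in_alg (D e`_i e`_j)) (in_dual (f i)).
Proof.
move=> tF; rewrite nybe_skew => /(congr1 (tlift3 F)).
have L : linear (tlift3 F) by exact: tlift_linear.
have sumF (x y z : 'I_n -> 'I_n -> B) :
    tlift3 F (\sum_i \sum_j x i j ⊗ y i j ⊗ z i j)
    = \sum_i \sum_j F (x i j) (y i j) (z i j).
  rewrite (linear_sumE L); apply: eq_bigr => i _; rewrite (linear_sumE L).
  by apply: eq_bigr => j _; rewrite (tlift3_pure tF).
by rewrite (linear_funB L) (linear_funD L) (linear_fun0 L) !sumF => /subr0_eq.
Qed.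

(** These maps extract the P-part and the S-part of [nybe_skew]: each kills
    the tensors with an A-component in a leg that it evaluates at u or v. *)
Lemma evaluation_trilinear (u v : V) :
  trilinear_fun (fun x y z : B => ((x.2 u : k) * (y.2 v : k)) *: z.1) /\
  trilinear_fun (fun x y z : B => ((y.2 u : k) * (z.2 v : k)) *: x.1).
Proof.
have evalD (w : V) a (p q : B) :
    ((a *: p + q).2 w : k) = a * (p.2 w : k) + (q.2 w : k).
  by rewrite add_lfunE scale_lfunE.
have fstD a (p q : B) : (a *: p + q).1 = a *: p.1 + q.1 by [].
split; split=> x y a p q; rewrite ?evalD ?fstD.
- by rewrite mulrDl -mulrA scalerDl scalerA.
- by rewrite mulrDr mulrCA scalerDl scalerA.
- by rewrite scalerDr !scalerA mulrC.
- by rewrite scalerDr !scalerA mulrC.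
- by rewrite mulrDl -mulrA scalerDl scalerA.
by rewrite mulrDr mulrCA scalerDl scalerA.
Qed.

(** If P and S vanish, so does D = P + S.  Conversely, the contraction by
    evaluation at u and v is the expansion of P(u, v), or of S(u, v), in the
    basis e. *)
Lemma nybe_skew_eq0 :
  nybe_lhs Ahat skew_fst skew_snd = 0 <-> forall u v, P u v = 0 /\ S u v = 0.
Proof.
split=> [E u v|PS0]; last first.
  rewrite nybe_skew !big1 ?subr0 ?addr0 // => i _; rewrite big1 // => j _.
  - have -> : D e`_i e`_j = 0.
      by rewrite [LHS]O_defectD !(proj1 (PS0 _ _)) !(proj2 (PS0 _ _)) addr0.
    by rewrite (linear_fun0 in_alg_linear) tens0r tens0l.
  - by rewrite (proj2 (PS0 _ _)) (linear_fun0 in_alg_linear) !tens0l.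
  - by rewrite (proj1 (PS0 _ _)) (linear_fun0 in_alg_linear) !tens0r.
have [tP tS] := evaluation_trilinear u v.
have sum0 (c : 'I_n -> 'I_n -> k) (x : 'I_n -> 'I_n -> A) :
    (forall i j, c i j = 0) -> \sum_i \sum_j c i j *: x i j = 0.
  move=> c0; rewrite big1 // => i _; rewrite big1 // => j _.
  by rewrite c0 scale0r.
split.
  have := contraction tP E.
  rewrite -(bilinear_expand e_basis (O_defect_bilinear _ _ _ _)).
  by rewrite !sum0 ?addr0 // => i j; rewrite /= zero_lfunE ?mul0r ?mulr0.
have := contraction tS E.
rewrite -(bilinear_expand e_basis (O_defect_bilinear _ _ _ _)).
by rewrite !sum0 ?add0r // => i j; rewrite /= zero_lfunE ?mul0r ?mulr0.
Qed.

End YangBaxter.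

(** * O-operators and the Yang-Baxter equation *)

Theorem theorem3p6 (k : fieldType) (char0 : [pchar k] =i pred0)
    (A V : vectType k) (N : ncNovikov A) (R : representation N V)
    (e : (\dim {:V}).-tuple V) (e_basis : basis_of {:V} e) (T : 'Hom(V, A)) :
  let Ahat : ncNovikov (dsum A (dual V)) := semidirect (dual_rep R) in
  let rT := embed (tensor_of e T) in
  let r := rT - tswap rT in
  (antisymmetric_tensor r /\ is_NYBE_solution Ahat r) <-> O_operator R T.
Proof.
move=> Ahat rT r.
apply: iff_trans (iff_sym (O_operator_defect T R)).
apply: iff_trans (nybe_skew_eq0 T e_basis R).
have rE := skew_tensorE T e; split=> [[_ solution]|E]; first exact: solution rE.
split=> [|m u v ruv]; first exact: antisymmetrize.
by rewrite -E; apply: nybe_lhs_wd; rewrite -ruv.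
Qed.
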